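(* For every pair of convex bodies $G$ and $K$ in $\mathbb{R}^d$ satisfying $0 \in \operatorname{int} G$ and $G \subset \operatorname{int} K$, and every $\alpha > 0$, $$\widehat{M}_H(G, K; \alpha) \;\leq\; 11 \, M_H\!\left(K^\circ, G^\circ; \frac{3\alpha}{16}\right)^{3}.$$
   Context: A convex body in $\mathbb{R}^d$ is a compact convex set with nonempty interior. For nonempty $S \subset \mathbb{R}^d$, its polar is $S^\circ = \{ y \in \mathbb{R}^d : \langle x, y\rangle \leq 1 \text{ for all } x \in S\}$. If $0 \in \operatorname{int} G$ and $G \subset \operatorname{int} K$, then $K^\circ, G^\circ$ are convex bodies with $0 \in \operatorname{int} K^\circ$ and $K^\circ \subset \operatorname{int} G^\circ$. Hilbert metric: for a convex body $L \subset \mathbb{R}^d$ with $0 \in \operatorname{int} L$ and $y \in \mathbb{R}^d$, write $f_y(x) = 1 - \langle y, x\rangle$. For $x_1, x_2 \in \operatorname{int} L$, $$\operatorname{dist}^H_L(x_1,x_2) = \frac12 \sup_{y,z \in L^\circ} \log\left( \frac{f_y(x_1)}{f_y(x_2)} \cdot \frac{f_z(x_2)}{f_z(x_1)} \right).$$ For nonempty $C \subset \operatorname{int} L$ and $x \in \operatorname{int} L$, $\operatorname{dist}^H_L(x, C) = \operatorname{dist}^H_L(C,x) = \inf_{c \in C} \operatorname{dist}^H_L(x,c)$. Packing numbers: let $S$ be a nonempty compact subset of $\operatorname{int} L$ and $\alpha > 0$. The Hilbert packing number $M_H(S, L; \alpha)$ is the maximum integer $N$ for which there exist $x_1, \dots,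 x_N \in S$ with $\operatorname{dist}^H_L(x_i,x_j) \geq \alpha$ for all $1 \leq i < j \leq N$. The Hilbert convexified packing number $\widehat{M}_H(S, L; \alpha)$ is the maximum integer $N$ for which there exists a sequence $x_1,\dots,x_N \in S$ with $\operatorname{dist}^H_L(x_j, \operatorname{conv}\{x_1,\dots,x_{j-1}\}) \geq \alpha$ for all $2 \leq j \leq N$. Both numbers are finite for every $\alpha>0$. *)

(* Defs.v *)
From HB Require Import structures.
From mathcomp Require Import all_boot all_order all_algebra.
From mathcomp Require Import all_classical all_reals all_analysis.

Set Implicit Arguments.
Unset Strict Implicit.
Unset Printing Implicit Defensive.

Import Order.TTheory GRing.Theory Num.Theory.
Import numFieldNormedType.Exports.

Local Open Scope classical_set_scope.
Local Open Scope ring_scope.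

(* The topology of 'rV[R]_d is the product topology, i.e. the usual topology
   of R^d. *)

Definition dotp (R : realType) (d : nat) (x y : 'rV[R]_d) : R :=
  \sum_(i < d) x ord0 i * y ord0 i.

Definition convex_body (R : realType) (d : nat) (L : set 'rV[R]_d) : Prop :=
  [/\ compact L, convex_set L & interior L !=set0].

Definition conv_hull (R : realType) (d : nat) (S : set 'rV[R]_d) :
    set 'rV[R]_d :=
  smallest (@convex_set R 'rV[R]_d) S.

Definition polar (R : realType) (d : nat) (S : set 'rV[R]_d) : set 'rV[R]_d :=
  [set y | forall x, S x -> dotp x y <= 1].

Definition polar_form (R : realType) (d : nat) (y x : 'rV[R]_d) : R :=
  1 - dotp y x.

(* For L a convex body with 0 in its interior and x1, x2 in the interior of L,
   the set below is nonempty and bounded, so that [sup] is its supremum. *)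
Definition hilbert_dist (R : realType) (d : nat) (L : set 'rV[R]_d)
    (x1 x2 : 'rV[R]_d) : R :=
  2^-1 * sup [set ln (polar_form y x1 / polar_form y x2 *
                      (polar_form z x2 / polar_form z x1))
             | y in polar L & z in polar L].

Definition hilbert_dist_set (R : realType) (d : nat) (L : set 'rV[R]_d)
    (x : 'rV[R]_d) (C : set 'rV[R]_d) : R :=
  inf [set hilbert_dist L x c | c in C].

(* The largest element of P; the default value 0 is taken only if P has no
   largest element, which does not occur for the packing numbers of a nonempty
   compact subset of the interior of a convex body. *)
Definition nat_max (P : set nat) : nat :=
  xget 0%N [set N | P N /\ forall n, P n -> (n <= N)%N].

Definition hilbert_packing (R : realType) (d : nat) (S L : set 'rV[R]_d)
    (alpha : R) (N : nat) : Prop :=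
  exists x : 'I_N -> 'rV[R]_d,
    (forall i, S (x i)) /\
    (forall i j : 'I_N, (i < j)%N -> alpha <= hilbert_dist L (x i) (x j)).

Definition hilbert_packing_number (R : realType) (d : nat)
    (S L : set 'rV[R]_d) (alpha : R) : nat :=
  nat_max (hilbert_packing S L alpha).

(* Indices start at 0, so every point but x_0 is compared with the convex hull
   of its predecessors. *)
Definition hilbert_conv_packing (R : realType) (d : nat) (S L : set 'rV[R]_d)
    (alpha : R) (N : nat) : Prop :=
  exists x : 'I_N -> 'rV[R]_d,
    (forall i, S (x i)) /\
    (forall j : 'I_N, (0 < j)%N ->
       alpha <= hilbert_dist_set L (x j)
                  (conv_hull [set x i | i in [set i : 'I_N | (i < j)%N]])).

Definition hilbert_conv_packing_number (R : realType) (d : nat)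
    (S L : set 'rV[R]_d) (alpha : R) : nat :=
  nat_max (hilbert_conv_packing S L alpha).

(* Main.v *)
Require Import Defs.
From HB Require Import structures.
From mathcomp Require Import all_boot all_order all_algebra.
From mathcomp Require Import all_classical all_reals all_analysis.
From mathcomp Require Import ring lra.

Set Implicit Arguments.
Unset Strict Implicit.
Unset Printing Implicit Defensive.

Import Order.TTheory GRing.Theory Num.Theory.
Import numFieldNormedType.Exports.

Local Open Scope classical_set_scope.
Local Open Scope ring_scope.

(** Write f_u(x) = 1 - <u, x>, so that f_u(x) = f_x(u), put beta = 3 alpha / 16
and e = exp(2 beta), and let M be the packing number of the polar of K. The
argument gives N <= M^3 for every convexified packing x_0, ..., x_{N-1} of G.

Since 3 beta < alpha, the Hilbert distance from x_j to every point c of the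
hull of its predecessors exceeds 3 beta, so some pair (y, z) in the polar of K
satisfies f_y(x_j) f_z(c) > e^3 f_y(c) f_z(x_j). A minimax argument makes
the pair independent of c ([separating_pair]): up to positive factors the
admissible pairs form a convex cone of affine functionals of c. Hence
each j comes with one pair (y_j, z_j) such that the ratio f_{y_j} / f_{z_j} is
at least e^3 times larger at x_j than at every earlier x_i
([conv_packing_separation]).

A maximal beta-packing of the polar of K is also a beta-net, so y_j and z_j lie
within beta of points a and b of the packing, and there are at most M^2 such
pairs (a, b). For indices j in one cluster, replacing (y_j, z_j) by (a, b) costs
a factor e twice, because the metric of the polar of G controls the
variation of f_y / f_a over points of G. So f_a / f_b still grows by a factor e
from each point of the cluster to the next.

If the cluster has k points, f_a / f_b thus grows by e^(k-1) between its first
point u and its last point v. Read dually, f_v / f_u varies by that factor along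
the segment from b to a, and the points of the segment where it equals
e^l times its value at b, for l < k, form a beta-packing
([segment_packing]). Hence k <= M ([cluster_card]), and N <= M^2 * M.

The packing number M has its meaning as a maximum only because packings of the
polar of K are bounded in size ([hilbert_packing_bounded]). This comes from
[polar_bounds]: f_u(y) is bounded away from 0 for y in the polar of K and u in
the bipolar of G, which makes the metric Lipschitz there. *)

(** * Polar forms and segments *)

Lemma dotpC (R : realType) (d : nat) (x y : 'rV[R]_d) : dotp x y = dotp y x.
Proof. by apply: eq_bigr => i _; rewrite mulrC. Qed.

Lemma dotpDr (R : realType) (d : nat) (x y z : 'rV[R]_d) :
  dotp x (y + z) = dotp x y + dotp x z.
Proof. by rewrite -big_split; apply: eq_bigr => i _; rewrite mxE mulrDr. Qed.

Lemma dotpZr (R : realType) (d : nat) (a : R) (x y : 'rV[R]_d) :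
  dotp x (a *: y) = a * dotp x y.
Proof. by rewrite mulr_sumr; apply: eq_bigr => i _; rewrite mxE mulrCA. Qed.

Lemma dotpDl (R : realType) (d : nat) (x y z : 'rV[R]_d) :
  dotp (x + y) z = dotp x z + dotp y z.
Proof. by rewrite dotpC dotpDr !(dotpC z). Qed.

Lemma dotpZl (R : realType) (d : nat) (a : R) (x y : 'rV[R]_d) :
  dotp (a *: x) y = a * dotp x y.
Proof. by rewrite dotpC dotpZr dotpC. Qed.

Lemma dot0p (R : realType) (d : nat) (x : 'rV[R]_d) : dotp 0 x = 0.
Proof. by rewrite -(scale0r 0) dotpZl mul0r. Qed.

Lemma polar_formC (R : realType) (d : nat) (x y : 'rV[R]_d) :
  polar_form x y = polar_form y x.
Proof. by rewrite /polar_form dotpC. Qed.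

Lemma polar_form_segment (R : realType) (d : nat) (u a b : 'rV[R]_d) (t : R) :
  polar_form u (t *: a + (1 - t) *: b) =
  t * polar_form u a + (1 - t) * polar_form u b.
Proof. by rewrite /polar_form dotpDr !dotpZr; ring. Qed.

Lemma polar0 (R : realType) (d : nat) (S : set 'rV[R]_d) : polar S 0.
Proof. by move=> x _; rewrite dotpC dot0p. Qed.

Lemma sub_bipolar (R : realType) (d : nat) (S : set 'rV[R]_d) :
  S `<=` polar (polar S).
Proof. by move=> x Sx y; rewrite dotpC; apply. Qed.

(** Convexity with a real parameter t, so that identities along a segment are
polynomial identities in t. *)
Definition segment_closed (R : realType) (E : lmodType R) (C : set E) : Prop :=
  forall x y t, C x -> C y -> 0 <= t -> t <= 1 -> C (t *: x + (1 - t) *: y).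

Lemma polar_segment_closed (R : realType) (d : nat) (S : set 'rV[R]_d) :
  segment_closed (polar S).
Proof.
move=> y z t Sy Sz t0 t1 x Sx; rewrite dotpDr !dotpZr.
by have := Sy x Sx; have := Sz x Sx; nra.
Qed.

Lemma conv_hull_segment_closed (R : realType) (d : nat) (S : set 'rV[R]_d) :
  segment_closed (conv_hull S).
Proof.
move=> x y t Cx Cy t0 t1 C [convC SC].
have := convC x y (Itv01 t0 t1).
by rewrite !inE; apply; [exact: Cx | exact: Cy].
Qed.

(** * Minimax for cones of affine functions *)

(** The planar case of the minimax argument: a convex cone that meets every open
half-plane t a + (1 - t) b > 0 with 0 <= t <= 1 meets the open positive
quadrant. With t / (1 - t) = s the half-plane reads s a + b > 0. Suppose that
the cone misses the quadrant, and let s0 be the infimum of the slopes - b / a of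
the elements of the cone with a > 0. An element positive at s0 must have
a <= 0 < b, and stays positive at some slope beyond s0, where an element with
a > 0 is positive too; the two of them have a combination in the quadrant after
all. *)
Lemma cone_two_points (R : realType) (S : R -> R -> Prop)
    (SD : forall a b a' b', S a b -> S a' b' -> S (a + a') (b + b'))
    (SZ : forall k a b, 0 < k -> S a b -> S (k * a) (k * b))
    (Spos : forall t, 0 <= t -> t <= 1 ->
       exists a b, S a b /\ 0 < t * a + (1 - t) * b) :
  exists a b, [/\ S a b, 0 < a & 0 < b].
Proof.
have Spos' s : 0 <= s -> exists a b, S a b /\ 0 < s * a + b.
  move=> s0; have s1 : 0 < 1 + s by lra.
  have [||a [b [Sab ab]]] := Spos (s / (1 + s)).
  - by apply: divr_ge0 => //; lra.
  - by rewrite ler_pdivrMr //; lra.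
  exists a, b; split=> //.
  have -> : s * a + b = (1 + s) * (s / (1 + s) * a + (1 - s / (1 + s)) * b).
    by field; lra.
  exact: mulr_gt0.
have [//|NS] := pselect (exists a b, [/\ S a b, 0 < a & 0 < b]).
have Sneg a b : S a b -> 0 < a -> b <= 0.
  by move=> Sab a0; rewrite leNgt; apply/negP => b0; apply: NS; exists a, b.
pose D := [set r | exists a b, [/\ S a b, 0 < a & r = - b / a]].
have D0 : D !=set0.
  have [||a [b [Sab]]] := Spos 1; [exact: ler01|exact: lexx|].
  by rewrite mul1r subrr mul0r addr0 => a0; exists (- b / a), a, b.
have Dlb : lbound D 0.
  move=> _ [a [b [Sab a0 ->]]]; apply: divr_ge0; last exact: ltW.
  by rewrite oppr_ge0; exact: Sneg Sab a0.
have s0 : 0 <= inf D by exact: lb_le_inf.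
have [a [b [Sab ab]]] := Spos' _ s0.
have a0 : a <= 0.
  rewrite leNgt; apply/negP => a0.
  have : inf D <= - b / a by apply: ge_inf; [exists 0 | exists a, b].
  by rewrite ler_pdivlMr //; lra.
have [|r [a' [b' [Sab' a'0 ->]]]] :=
    @inf_lt _ D (inf D + (inf D * a + b) / (1 - a)) D0.
  by rewrite ltrDl; apply: divr_gt0 => //; lra.
(* s is chosen so that s a + b = (s0 a + b) / (1 - a), which is positive. *)
set s := inf D + _; rewrite ltr_pdivrMr // => ab'.
have sab : 0 < s * a + b.
  have -> : s * a + b = (inf D * a + b) / (1 - a) by rewrite /s; field; lra.
  by apply: divr_gt0 => //; lra.
have b'0 : b' <= 0 := Sneg _ _ Sab' a'0.
have X0 : 0 < a' * b - a * b' by nra.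
set X := _ - _ in X0.
have e0 : 0 < X / (1 - b') by apply: divr_gt0 => //; lra.
(* The combination with weights a' and - a has coordinates (0, X); the extra
   weight X / (1 - b') on (a', b') makes both coordinates positive. *)
exists (a' * a + (- a + X / (1 - b')) * a'),
       (a' * b + (- a + X / (1 - b')) * b'); split.
- by apply: SD; apply: SZ => //; lra.
- have -> : a' * a + (- a + X / (1 - b')) * a' = a' * (X / (1 - b')) by ring.
  exact: mulr_gt0.
- have -> : a' * b + (- a + X / (1 - b')) * b' = X / (1 - b').
    by rewrite /X; field; lra.
  exact: e0.
Qed.

(** Adding the point x to s restricts F to the subcone of the f positive at x,
and [cone_two_points], applied to the values at c and x, shows that this subcone
still has an element positive at each c in C. Thus convex combinations of more
than two points never appear. *)
Lemma cone_minimax (R : realType) (E : lmodType R) (C : set E)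
    (C_seg : segment_closed C) (s : seq E) (F : set (E -> R))
    (FD : forall f g, F f -> F g -> F (fun x => f x + g x))
    (FZ : forall k f, 0 < k -> F f -> F (fun x => k * f x))
    (Faff : forall f x y t, F f ->
       f (t *: x + (1 - t) *: y) = t * f x + (1 - t) * f y)
    (F0 : F !=set0)
    (Fpos : forall c, C c -> exists2 f, F f & 0 < f c)
    (sC : forall x, x \in s -> C x) :
  exists2 f, F f & forall x, x \in s -> 0 < f x.
Proof.
elim: s F FD FZ Faff F0 Fpos sC => [|x s IHs] F FD FZ Faff [f0 Ff0] Fpos sC.
  by exists f0.
have Cx : C x by apply: sC; rewrite mem_head.
have [|||||y ys|f [Ff fx] fs] := IHs [set f | F f /\ 0 < f x].
- by move=> f g [Ff fx] [Fg gx]; split; [exact: FD | exact: addr_gt0].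
- by move=> k f k0 [Ff fx]; split; [exact: FZ | exact: mulr_gt0].
- by move=> f y z t [Ff _]; exact: Faff.
- by have [f Ff fx] := Fpos x Cx; exists f.
- move=> c Cc.
  have [||t t0 t1|_ [_ [[f Ff [-> ->]] fc fx]]] := @cone_two_points R
      (fun a b => exists2 f, F f & a = f c /\ b = f x).
  + move=> _ _ _ _ [f Ff [-> ->]] [g Fg [-> ->]].
    by exists (fun x => f x + g x) => //; exact: FD.
  + move=> k _ _ k0 [f Ff [-> ->]].
    by exists (fun x => k * f x) => //; exact: FZ.
  + have [f Ff] := Fpos _ (C_seg _ _ _ Cc Cx t0 t1).
    by rewrite Faff // => ftc; exists (f c), (f x); split=> //; exists f.
  by exists f.
- by apply: sC; rewrite in_cons ys orbT.
by exists f => // y; rewrite in_cons => /orP[/eqP ->|/fs].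
Qed.

(** Fix x. Each pair (y, z) is sought through p = f_y and q = f_z rescaled so
that p(x) = q(x); the condition at c is then q(c) - e p(c) > 0. Positive multiples
of the f_y with y in the polar are the functionals A - <B, .> with
A > 0 and <B, .> <= A on K, so these differences form a convex cone,
to which [cone_minimax] applies. *)
Lemma separating_pair (R : realType) (d : nat) (K C : set 'rV[R]_d)
    (C_seg : segment_closed C) (x : 'rV[R]_d) (s : seq 'rV[R]_d) (theta : R)
    (x_pos : forall y, polar K y -> 0 < polar_form y x)
    (C_pos : forall y c, polar K y -> C c -> 0 < polar_form y c)
    (sC : forall c, c \in s -> C c)
    (far : forall c, C c -> theta < hilbert_dist K x c) :
  exists y z, [/\ polar K y, polar K z &
    forall c, c \in s -> expR (2 * theta) * (polar_form y c * polar_form z x) <=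
                         polar_form y x * polar_form z c].
Proof.
(* A pair p = (A, B) stands for the affine functional A - <B, .>. *)
set e := expR _.
pose cone (p : R * 'rV[R]_d) := 0 < p.1 /\ forall k, K k -> dotp p.2 k <= p.1.
pose val (p : R * 'rV[R]_d) c := p.1 - dotp p.2 c.
pose F := [set f | exists p q, [/\ cone p, cone q, val p x = val q x &
                     f = fun c => val q c - e * val p c]].
have valD p q c : val (p + q) c = val p c + val q c.
  by rewrite /val /= dotpDl; ring.
have valZ k p c : val (k * p.1, k *: p.2) c = k * val p c.
  by rewrite /val /= dotpZl; ring.
have coneD p q : cone p -> cone q -> cone (p + q).
  move=> [p0 pK] [q0 qK]; split=> [|k Kk /=]; first exact: addr_gt0.
  by rewrite dotpDl lerD ?pK ?qK.
have coneZ k p : 0 < k -> cone p -> cone (k * p.1, k *: p.2).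
  move=> k0 [p0 pK]; split=> [|c Kc /=]; first exact: mulr_gt0.
  by rewrite dotpZl ler_pM2l // pK.
have polar_cone y : polar K y -> cone (1, y).
  by move=> Ky; split=> [|k Kk]; [exact: ltr01 | rewrite dotpC; exact: Ky].
have cone_polar p : cone p -> polar K (p.1^-1 *: p.2).
  move=> [p0 pK] k Kk.
  by rewrite dotpC dotpZl mulrC ler_pdivrMr // mul1r pK.
have val_polar p c : cone p -> val p c = p.1 * polar_form (p.1^-1 *: p.2) c.
  move=> [p0 _]; rewrite /polar_form dotpZl /val; field.
  by rewrite gt_eqF.
have [||||c Cc||f [p [q [cp cq pqx ->]]] fs] :=
  cone_minimax C_seg (s := s) (F := F).
- move=> _ _ [p [q [cp cq pqx ->]]] [p' [q' [cp' cq' pqx' ->]]].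
  exists (p + p'), (q + q'); split; [exact: coneD..| |].
  + by rewrite !valD pqx pqx'.
  + by apply/funext => c; rewrite !valD; ring.
- move=> k _ k0 [p [q [cp cq pqx ->]]].
  exists (k * p.1, k *: p.2), (k * q.1, k *: q.2).
  split; [exact: coneZ..| |].
  + by rewrite !valZ pqx.
  + by apply/funext => c; rewrite !valZ; ring.
- move=> _ y z t [p [q [_ _ _ ->]]].
  by rewrite /val !dotpDr !dotpZr; ring.
- pose p : R * 'rV[R]_d := (1, 0).
  exists (fun c => val p c - e * val p c), p, p.
  by split=> //; exact: (polar_cone _ (@polar0 _ _ K)).
- have := far c Cc; rewrite /hilbert_dist mulrC ltr_pdivlMr // mulrC.
  move=> /sup_gt[|_ [y Ky [z Kz <-]]].
    by eexists; exists 0; [exact: polar0|exists 0; [exact: polar0|reflexivity]].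
  have yx := x_pos _ Ky; have zx := x_pos _ Kz.
  have yc := C_pos _ _ Ky Cc; have zc := C_pos _ _ Kz Cc.
  rewrite -ltr_expR lnK ?posrE; last by rewrite mulr_gt0 // divr_gt0.
  rewrite mulf_div ltr_pdivlMr ?mulr_gt0 // => lt.
  pose p : R * 'rV[R]_d := (1, y); pose q : R * 'rV[R]_d := (1, z).
  exists (fun c => val (val p x * q.1, val p x *: q.2) c -
              e * val (val q x * p.1, val q x *: p.2) c).
    exists (val q x * p.1, val q x *: p.2), (val p x * q.1, val p x *: q.2).
    split=> //; [exact/coneZ/polar_cone..|].
    by rewrite !valZ mulrC.
  by rewrite !valZ subr_gt0 [val q x * _]mulrC.
- exact: sC.
exists (p.1^-1 *: p.2), (q.1^-1 *: q.2); split; [exact: cone_polar..|].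
move=> c /fs; rewrite subr_gt0 => lt.
move: pqx lt; rewrite !val_polar //.
have := x_pos _ (cone_polar _ cp).
set yx := polar_form _ x; set zx := polar_form _ x; set yc := polar_form _ c.
set zc := polar_form _ c => yx0 pqx lt.
case: cp cq => [+ _] [+ _]; set P := p.1; set Q := q.1 => P0 Q0.
rewrite -(ler_pM2l P0) -(ler_pM2l Q0).
have -> : Q * (P * (e * (yc * zx))) = (Q * zx) * (e * (P * yc)) by ring.
have -> : Q * (P * (yx * zc)) = (P * yx) * (Q * zc) by ring.
by rewrite -pqx; apply: ler_wpM2l; rewrite ltW // mulr_gt0.
Qed.

(** * Bounds on polar forms *)

Lemma compact_interior_dilate (R : realType) (d : nat) (G K : set 'rV[R]_d) :
  compact G -> G `<=` interior K ->
  exists2 e : R, 0 < e & forall g, G g -> K ((1 + e) *: g).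
Proof.
move=> /compact_near_coveringP cG GK.
have : \forall e \near (0 : R), G `<=` (fun g => K ((1 + e) *: g)).
  apply: (cG R (nbhs (0 : R)) (fun e g => K ((1 + e) *: g))) => g Gg.
  have : (1 + p.2) *: p.1 @[p --> (g, (0 : R))] --> (1 + 0 : R) *: g.
    apply: cvgZ; last exact: cvg_fst.
    by apply: cvgD; [exact: cvg_cst | exact: cvg_snd].
  by apply; rewrite addr0 scale1r; exact: GK.
move=> /nbhs_ballP[e /= e0 He]; exists (e / 2); first by rewrite divr_gt0.
move=> g Gg; apply: He => //; rewrite /ball /= sub0r normrN gtr0_norm; lra.
Qed.

Lemma compact_coord_bounded (R : realType) (d : nat) (G : set 'rV[R]_d) :
  compact G -> exists2 B : R, 0 < B & forall g i, G g -> `|g ord0 i| <= B.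
Proof.
move=> /compact_bounded[M [_ HM]]; exists (`|M| + 1); first by rewrite ltr_pwDr.
move=> g i Gg; apply: le_trans (HM (`|M| + 1) _ g Gg).
  rewrite [leRHS]mx_normrE.
  exact: (le_bigmax _ (fun ij : 'I_1 * 'I_d => `|g ij.1 ij.2|) (ord0, i)).
by rewrite (le_lt_trans (ler_norm M)) // ltrDl.
Qed.

Lemma dotp_delta (R : realType) (d : nat) (x : 'rV[R]_d) (i : 'I_d) :
  dotp x (delta_mx ord0 i) = x ord0 i.
Proof.
rewrite /dotp (bigD1 i) //= mxE !eqxx mulr1 big1 ?addr0 // => j ji.
by rewrite mxE (negbTE ji) andbF mulr0.
Qed.

Lemma interior_delta (R : realType) (d : nat) (K : set 'rV[R]_d) :
  interior K 0 -> exists2 r : R, 0 < r &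
    forall i, K (r *: delta_mx ord0 i) /\ K (- r *: delta_mx ord0 i).
Proof.
move=> K0.
have : \forall r \near (0 : R), forall i, K (r *: (delta_mx ord0 i : 'rV[R]_d)).
  apply: (@filter_forall _ 'I_d
    (fun i => [set r : R | K (r *: (delta_mx ord0 i : 'rV[R]_d))])
    (nbhs (0 : R)) _) => i.
  have : r *: (delta_mx ord0 i : 'rV[R]_d) @[r --> (0 : R)] -->
         (0 : R) *: (delta_mx ord0 i : 'rV[R]_d).
    by apply: cvgZ; [exact: cvg_id | exact: cvg_cst].
  by apply; rewrite scale0r; exact: K0.
move=> /nbhs_ballP[e /= e0 He]; exists (e / 2); first by rewrite divr_gt0.
move=> i; split; apply: He;
  rewrite /ball /= sub0r normrN ?normrN gtr0_norm; lra.
Qed.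

Lemma polar_coord_bounded (R : realType) (d : nat) (S : set 'rV[R]_d) (r : R)
    (r_gt0 : 0 < r)
    (Sr : forall i, S (r *: delta_mx ord0 i) /\ S (- r *: delta_mx ord0 i))
    (y : 'rV[R]_d) (i : 'I_d) :
  polar S y -> `|y ord0 i| <= r^-1.
Proof.
move=> Sy; have [/Sy + /Sy] := Sr i.
rewrite !dotpZl dotpC dotp_delta -[r^-1]mulr1 ler_norml => H1 H2.
by rewrite ler_pdivlMl // lerNl ler_pdivlMl // mulrN -mulNr H1 H2.
Qed.

(** By compactness (1 + e) G lies in K for some e > 0. So (1 + e) y is in the
polar of G for y in the polar of K, whence <u, y> <= 1 / (1 + e) for every u
in the bipolar of G. The coordinate bounds hold because K and the polar of
G contain small multiples of the coordinate vectors and their opposites. *)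
Lemma polar_bounds (R : realType) (d : nat) (G K : set 'rV[R]_d)
    (cG : compact G) (G0 : interior G 0) (GK : G `<=` interior K) :
  exists delta B : R, [/\ 0 < delta, 0 <= B,
    forall y i, polar K y -> `|y ord0 i| <= B,
    forall u i, polar (polar G) u -> `|u ord0 i| <= B &
    forall u y, polar (polar G) u -> polar K y -> delta <= polar_form u y].
Proof.
have [e e0 GeK] := compact_interior_dilate cG GK.
have [C C0 GC] := compact_coord_bounded cG.
have [r r0 Kr] := interior_delta (GK _ (interior_subset G0)).
have e1 : 0 < 1 + e by lra.
have r'0 : 0 < r^-1 by rewrite invr_gt0.
have C'0 : 0 < C^-1 by rewrite invr_gt0.
exists (e / (1 + e)), (r^-1 + C); split.
- exact: divr_gt0.
- by rewrite addr_ge0 // ltW.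
- move=> y i Ky; apply: le_trans (polar_coord_bounded r0 Kr i Ky) _.
  by rewrite lerDl ltW.
- move=> u i Gu; apply: (@le_trans _ _ C); last by rewrite lerDr ltW.
  rewrite -[C]invrK; apply: (@polar_coord_bounded _ _ (polar G)) => // j.
  split=> g Gg.
    rewrite dotpZr dotp_delta mulrC ler_pdivrMr // mul1r.
    by rewrite (le_trans (ler_norm _)) ?GC.
  rewrite dotpZr dotp_delta mulrC mulrN -mulNr ler_pdivrMr // mul1r.
  by rewrite (le_trans (ler_norm _)) ?normrN ?GC.
- move=> u y Gu Ky.
  have /Gu : polar G ((1 + e) *: y).
    by move=> g Gg; rewrite dotpZr -dotpZl; apply/Ky/GeK.
  rewrite dotpZl dotpC /polar_form ler_pdivrMr //; nra.
Qed.

(** * The Hilbert metric where polar forms are bounded below *)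

Lemma polar_form_log_le (R : realType) (d : nat) (delta B eta : R)
    (u y z : 'rV[R]_d) (delta_gt0 : 0 < delta)
    (uB : forall i, `|u ord0 i| <= B)
    (yz : forall i, `|y ord0 i - z ord0 i| <= eta)
    (uy : delta <= polar_form u y) (uz : delta <= polar_form u z) :
  ln (polar_form u y / polar_form u z) <= d%:R * B * eta / delta.
Proof.
have uy0 := lt_le_trans delta_gt0 uy; have uz0 := lt_le_trans delta_gt0 uz.
have num : polar_form u y - polar_form u z <= d%:R * B * eta.
  have -> : polar_form u y - polar_form u z = dotp u (z - y).
    by rewrite -(scaleN1r y) dotpDr dotpZr /polar_form; ring.
  rewrite -mulrA mulr_natl -[X in _ *+ X]card_ord -sumr_const ler_sum // => i _.
  rewrite (le_trans (ler_norm _)) // normrM ler_pM // !mxE distrC.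
  exact: yz.
have B0 : 0 <= d%:R * B * eta.
  case: (posnP d) => [d0|d0]; first by rewrite d0 !mul0r.
  have i : 'I_d by exists 0%N.
  by rewrite !mulr_ge0 ?(le_trans _ (uB i)) ?(le_trans _ (yz i)).
have -> : polar_form u y / polar_form u z =
          1 + (polar_form u y - polar_form u z) / polar_form u z.
  by field; rewrite gt_eqF.
apply: le_trans (le_ln1Dx _) _.
  by rewrite ltr_pdivlMr //; lra.
rewrite ler_pdivrMr // (le_trans num) // -[leRHS]mulrA ler_peMr //.
by rewrite ler_pdivlMl ?mulr1.
Qed.

Lemma hilbert_log_ubound (R : realType) (d : nat) (L : set 'rV[R]_d)
    (delta B eta : R) (y z : 'rV[R]_d) (delta_gt0 : 0 < delta)
    (LB : forall u i, polar L u -> `|u ord0 i| <= B)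
    (yz : forall i, `|y ord0 i - z ord0 i| <= eta)
    (Ly : forall u, polar L u -> delta <= polar_form u y)
    (Lz : forall u, polar L u -> delta <= polar_form u z) :
  ubound [set ln (polar_form u y / polar_form u z *
                  (polar_form v z / polar_form v y))
         | u in polar L & v in polar L] (2 * (d%:R * B * eta / delta)).
Proof.
have pos u w : polar L u -> delta <= polar_form u w -> 0 < polar_form u w.
  by move=> _; exact: lt_le_trans.
move=> _ [u Lu [v Lv <-]].
rewrite lnM ?posrE ?divr_gt0 ?(pos _ _ Lu) ?(pos _ _ Lv) ?Ly ?Lz //.
rewrite [leRHS]mulr_natl mulr2n lerD //;
  apply: polar_form_log_le; rewrite ?Ly ?Lz // => i.
all: by rewrite ?LB // distrC.
Qed.

Lemma hilbert_dist_le (R : realType) (d : nat) (L : set 'rV[R]_d)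
    (delta B eta : R) (y z : 'rV[R]_d) (delta_gt0 : 0 < delta)
    (LB : forall u i, polar L u -> `|u ord0 i| <= B)
    (yz : forall i, `|y ord0 i - z ord0 i| <= eta)
    (Ly : forall u, polar L u -> delta <= polar_form u y)
    (Lz : forall u, polar L u -> delta <= polar_form u z) :
  hilbert_dist L y z <= d%:R * B * eta / delta.
Proof.
rewrite /hilbert_dist ler_pdivrMl //.
apply: ge_sup; last exact: hilbert_log_ubound.
by eexists; exists 0; [exact: polar0|exists 0; [exact: polar0|reflexivity]].
Qed.

(** Reading the distance back from its supremum requires the set of logarithms to
be bounded above, which [hilbert_log_ubound] provides. *)
Lemma hilbert_dist_ge (R : realType) (d : nat) (L : set 'rV[R]_d)
    (delta B : R) (y z : 'rV[R]_d) (delta_gt0 : 0 < delta)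
    (LB : forall u i, polar L u -> `|u ord0 i| <= B)
    (Ly : forall u, polar L u -> delta <= polar_form u y)
    (Lz : forall u, polar L u -> delta <= polar_form u z)
    (u v : 'rV[R]_d) :
  polar L u -> polar L v ->
  polar_form u y * polar_form v z <=
  expR (2 * hilbert_dist L y z) * (polar_form u z * polar_form v y).
Proof.
move=> Lu Lv.
have [uy uz vy vz] : [/\ 0 < polar_form u y, 0 < polar_form u z,
    0 < polar_form v y & 0 < polar_form v z].
  by split; apply: lt_le_trans delta_gt0 _; rewrite ?Ly ?Lz.
rewrite -ler_pdivrMr ?mulr_gt0 // -mulf_div -[leLHS]lnK; last first.
  by rewrite posrE mulr_gt0 ?divr_gt0.
rewrite ler_expR /hilbert_dist mulVKf //.
apply: ub_le_sup; last by exists u => //; exists v.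
eexists; apply: (hilbert_log_ubound (eta := \sum_i `|y ord0 i - z ord0 i|)
  delta_gt0 LB) => // i.
by rewrite (bigD1 i) //= lerDl sumr_ge0.
Qed.

(** * Packing numbers *)

(** Two points in the same cell of a grid of mesh eta cannot be eta-separated, so
the number of cells bounds the number of points. *)
Lemma separated_bounded (R : realType) (d : nat) (B eta : R) (B_ge0 : 0 <= B)
    (eta_gt0 : 0 < eta) :
  exists m, forall N (x : 'I_N -> 'rV[R]_d),
    (forall i k, `|x i ord0 k| <= B) ->
    (forall i j : 'I_N, (i < j)%N ->
       exists k, eta < `|x i ord0 k - x j ord0 k|) ->
    (N <= m)%N.
Proof.
pose cell t := Num.truncn ((t + B) / eta).
pose m := (cell B).+1.
exists #|{ffun 'I_d -> 'I_m}| => N x xB xsep.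
pose f i := [ffun k => inord (cell (x i ord0 k)) : 'I_m].
rewrite -{1}(card_ord N); apply: (leq_card f).
suff sep (i j : 'I_N) : (i < j)%N -> f i <> f j.
  move=> i j fij; apply: val_inj; case: (ltngtP i j) => // /sep; first by case.
  by rewrite fij.
move=> ij /ffunP fij; have [k] := xsep _ _ ij.
have cellP l : (cell (x l ord0 k))%:R * eta <= x l ord0 k + B <
    (cell (x l ord0 k))%:R * eta + eta.
  have := xB l k; rewrite ler_norml => /andP[xl _].
  have /truncn_itv/andP[] : 0 <= (x l ord0 k + B) / eta.
    by rewrite divr_ge0 // ?(ltW eta_gt0) //; lra.
  rewrite ler_pdivlMr // ltr_pdivrMr // -[_.+1%:R]natr1 => xl1 xl2.
  by apply/andP; split; last by move: xl2; rewrite [ltRHS]mulrDl mul1r.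
have cell_lt l : (cell (x l ord0 k) < m)%N.
  rewrite ltnS; apply: le_truncn; rewrite ler_pM2r ?invr_gt0 // lerD2r.
  by rewrite (le_trans (ler_norm _)).
have := fij k; rewrite !ffunE => /(congr1 val) /=; rewrite !inordK //.
have := cellP i; have := cellP j => + + e; rewrite e.
by move=> /andP[? ?] /andP[? ?]; rewrite ltNge ler_norml; case/negP; lra.
Qed.

Lemma nat_maxP (P : set nat) (m n : nat) :
  P n -> (forall k, P k -> (k <= m)%N) ->
  P (nat_max P) /\ forall k, P k -> (k <= nat_max P)%N.
Proof.
move=> Pn Pm.
apply: (@xgetPex _ 0%N [set N | P N /\ forall k, P k -> (k <= N)%N]).
have ex : exists n, `[< P n >] by exists n; apply/asboolP.
have ub k : `[< P k >] -> (k <= m)%N by move=> /asboolP; exact: Pm.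
case: (ex_maxnP ex ub) => N /asboolP PN Nmax.
by exists N; split=> // k Pk; apply/Nmax/asboolP.
Qed.

(** * Packings along a segment *)

(** The indices in J need not be consecutive, so the growth is accumulated by
removing the last element v of J. *)
Lemma chain_growth (R : realType) (N : nat) (r : 'I_N -> R) (e : R)
    (J : {set 'I_N}) (e_ge0 : 0 <= e)
    (step : forall i j, i \in J -> j \in J -> (i < j)%N -> e * r i <= r j)
    (v : 'I_N) (vJ : v \in J) (vmax : forall i, i \in J -> (i <= v)%N) :
  exists2 u, u \in J & e ^+ #|J|.-1 * r u <= r v.
Proof.
move: {2}#|J|.-1 (erefl #|J|.-1) => k.
elim: k J v step vJ vmax => [|k IHk] J v step vJ vmax Jk.
  by exists v => //; rewrite Jk expr0 mul1r.
have cardJ : #|J :\ v| = k.+1.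
  by move: Jk; rewrite (cardsD1 v J) vJ.
have [w0 w0J] : exists w, w \in J :\ v by apply/card_gt0P; rewrite cardJ.
case: (arg_maxnP (fun w : 'I_N => (w : nat)) w0J) => w wJ wmax.
have [||u uJ uw] := IHk (J :\ v) w _ wJ wmax.
- by move=> i j; rewrite !inE => /andP[_ iJ] /andP[_ jJ]; exact: step.
- by rewrite cardJ.
have {}uJ : u \in J by case/setD1P: uJ.
have /setD1P[wv {}wJ] : w \in J :\ v := wJ.
exists u => //; rewrite Jk exprS -mulrA.
apply: le_trans (step w v wJ vJ _); last by rewrite ltn_neqAle wv vmax.
by apply: ler_wpM2l => //; move: uw; rewrite cardJ.
Qed.

(** The quotient f_v / f_u of two polar forms is a monotone homographic function
of the parameter of the segment from b to a. It therefore takes each value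
rho e^l, l <= n, between its values rho at b and at least rho e^n at a, and two
points where it differs by a factor e are at distance at least beta. *)
Lemma segment_packing (R : realType) (d : nat) (A L : set 'rV[R]_d)
    (delta B beta : R) (delta_gt0 : 0 < delta) (beta_gt0 : 0 < beta)
    (A_seg : segment_closed A)
    (LB : forall u i, polar L u -> `|u ord0 i| <= B)
    (LA : forall u w, polar L u -> A w -> delta <= polar_form u w)
    (a b u v : 'rV[R]_d) (Aa : A a) (Ab : A b) (Lu : polar L u) (Lv : polar L v)
    (n : nat) :
  expR (2 * beta) ^+ n * (polar_form u a / polar_form u b) <=
    polar_form v a / polar_form v b ->
  hilbert_packing A L beta n.+1.
Proof.
set e := expR _ => growth.
have pos x w : polar L x -> A w -> 0 < polar_form x w.
  by move=> Lx Aw; apply: lt_le_trans (LA _ _ Lx Aw).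
have [ua ub va vb] : [/\ 0 < polar_form u a, 0 < polar_form u b,
    0 < polar_form v a & 0 < polar_form v b] by split; exact: pos.
have e_gt1 : 1 < e by rewrite expR_gt1 mulr_gt0.
have e_gt0 : 0 < e := lt_trans ltr01 e_gt1.
pose rho := polar_form v b / polar_form u b.
have rho_gt0 : 0 < rho by exact: divr_gt0.
have inter (l : 'I_n.+1) :
    exists w, A w /\ polar_form v w = rho * e ^+ l * polar_form u w.
  set s := rho * e ^+ l.
  have P0 : 0 <= s * polar_form u b - polar_form v b.
    have -> : s * polar_form u b = e ^+ l * polar_form v b.
      by rewrite /s /rho; field; rewrite gt_eqF.
    by rewrite subr_ge0 ler_peMl ?exprn_ege1 ?ltW.
  have Q0 : 0 <= polar_form v a - s * polar_form u a.
    rewrite subr_ge0.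
    have : e ^+ l * (polar_form u a / polar_form u b) <=
           polar_form v a / polar_form v b.
      apply: le_trans growth; rewrite ler_pM2r ?divr_gt0 //.
      by rewrite ler_eXn2l // -ltnS.
    rewrite ler_pdivlMr //.
    have -> // : s * polar_form u a =
            e ^+ l * (polar_form u a / polar_form u b) * polar_form v b.
      by rewrite /s /rho; field; rewrite gt_eqF.
  move PE: (_ - _) P0 => P P0; move QE: (_ - _) Q0 => Q Q0.
  (* The parameter t solves t Q = (1 - t) P; when P = Q = 0 the quotient is
     constant on the segment and the value t = 0 given by division by 0 works. *)
  exists (P / (P + Q) *: a + (1 - P / (P + Q)) *: b); split.
    apply: A_seg => //; first by rewrite divr_ge0 ?addr_ge0.
    have [->|PQ] := eqVneq (P + Q) 0; first by rewrite invr0 mulr0 ler01.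
    by rewrite ler_pdivrMr ?mul1r ?lerDl // lt_def PQ addr_ge0.
  rewrite !polar_form_segment; apply/eqP; rewrite -subr_eq0.
  set t := P / _.
  have -> : t * polar_form v a + (1 - t) * polar_form v b -
    s * (t * polar_form u a + (1 - t) * polar_form u b) = t * (P + Q) - P.
    by rewrite -PE -QE; ring.
  rewrite subr_eq0; have [PQ|PQ] := eqVneq (P + Q) 0; last by rewrite divfK.
  by rewrite PQ mulr0 eq_le P0 /=; move: PQ; lra.
have [w Hw] := choice inter.
exists w; split=> [l|i j ij]; first by have [] := Hw l.
have [[Ai vi] [Aj vj]] := (Hw i, Hw j).
have [ui uj] := (pos _ _ Lu Ai, pos _ _ Lu Aj).
have := hilbert_dist_ge delta_gt0 LB (fun x Lx => LA x _ Lx Ai)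
  (fun x Lx => LA x _ Lx Aj) Lu Lv.
rewrite vi vj; set h := hilbert_dist _ _ _ => H.
have {}H : e ^+ j <= expR (2 * h) * e ^+ i.
  have c0 : 0 < polar_form u (w i) * polar_form u (w j) * rho.
    by apply: mulr_gt0 => //; exact: mulr_gt0.
  rewrite -(ler_pM2l c0); apply: le_trans (le_trans H _).
    by rewrite le_eqVlt; apply/orP; left; apply/eqP; ring.
  by rewrite le_eqVlt; apply/orP; left; apply/eqP; ring.
have : e <= expR (2 * h).
  have ei : 0 < e ^+ i by rewrite exprn_gt0.
  rewrite -(ler_pM2r ei); apply: le_trans H.
  by rewrite -exprS ler_eXn2l.
by rewrite ler_expR ler_pM2l.
Qed.

(** * Clusters of a convexified packing *)

Lemma hilbert_packing_bounded (R : realType) (d : nat) (A L : set 'rV[R]_d)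
    (delta B beta : R) (delta_gt0 : 0 < delta) (B_ge0 : 0 <= B)
    (beta_gt0 : 0 < beta)
    (AB : forall w i, A w -> `|w ord0 i| <= B)
    (LB : forall u i, polar L u -> `|u ord0 i| <= B)
    (LA : forall u w, polar L u -> A w -> delta <= polar_form u w) :
  exists m, forall n, hilbert_packing A L beta n -> (n <= m)%N.
Proof.
have c0 : 0 < d%:R * B / delta + 1.
  by rewrite ltr_wpDl // divr_ge0 ?mulr_ge0 // ltW.
have [m Hm] := separated_bounded d B_ge0 (divr_gt0 beta_gt0 c0).
exists m => n [w [Aw wsep]]; apply: (Hm n w) => [i k|i j ij]; first exact: AB.
apply: contrapT => near; have := wsep _ _ ij; rewrite leNgt; case/negP.
apply: le_lt_trans (hilbert_dist_le delta_gt0 LB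
    (eta := beta / (d%:R * B / delta + 1)) _ (fun x Lx => LA x _ Lx (Aw i))
    (fun x Lx => LA x _ Lx (Aw j))) _.
  by move=> k; rewrite leNgt; apply/negP => far; apply: near; exists k.
rewrite mulrAC mulrA ltr_pdivrMr // mulrC mulrDr mulr1 ltrDl //.
Qed.

(** A maximal packing is a net: a point far from all x i could be appended. *)
Lemma hilbert_packing_cover (R : realType) (d : nat) (A L : set 'rV[R]_d)
    (beta : R) (n : nat) (x : 'I_n -> 'rV[R]_d) (Ax : forall i, A (x i))
    (sep : forall i j : 'I_n, (i < j)%N -> beta <= hilbert_dist L (x i) (x j))
    (nmax : ~ hilbert_packing A L beta n.+1) (y : 'rV[R]_d) :
  A y -> exists i, hilbert_dist L (x i) y < beta.
Proof.
move=> Ay; apply: contrapT => far; apply: nmax.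
exists (fun i => oapp x y (insub (val i))); split=> [i|i j ij].
  by case: insub.
have ltin : (i < n)%N by rewrite (leq_trans ij) // -ltnS.
rewrite insubT /=; case: insubP => [j' _ jE|_] /=.
  by apply: sep; rewrite /= jE.
by rewrite leNgt; apply/negP => lt; apply: far; eexists; exact: lt.
Qed.

(** When the set of logarithms is unbounded its [sup] is 0 by convention, and
otherwise it is at least ln 1 = 0, which y = z = 0 gives. *)
Lemma hilbert_dist_ge0 (R : realType) (d : nat) (L : set 'rV[R]_d)
    (x c : 'rV[R]_d) :
  0 <= hilbert_dist L x c.
Proof.
rewrite /hilbert_dist mulr_ge0 //; set S := [set _ | _ in _ & _ in _].
have [[_ Sub]|/sup_out -> //] := pselect (has_sup S).
apply: ub_le_sup => //; exists 0; first exact: polar0.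
exists 0; first exact: polar0.
by rewrite /polar_form !dot0p subr0 divr1 mulr1 ln1.
Qed.

Lemma conv_hull_polar_form_gt0 (R : realType) (d : nat) (S : set 'rV[R]_d)
    (y : 'rV[R]_d) :
  (forall c, S c -> 0 < polar_form y c) ->
  conv_hull S `<=` [set c | 0 < polar_form y c].
Proof.
move=> Spos; apply: smallest_sub => // a b l; rewrite !inE => ya yb.
have -> : conv l a b = l%:num *: (a : 'rV[R]_d) + (1 - l%:num) *: b by [].
change (0 < polar_form y (l%:num *: (a : 'rV[R]_d) + (1 - l%:num) *: b)).
rewrite polar_form_segment.
have [l0 l1] : 0 <= l%:num /\ l%:num <= 1 by split; [exact: ge0|exact: le1].
move: ya yb l0 l1; rewrite /=; move: (polar_form y a) (polar_form y b) (l%:num).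
move=> p q t p0 q0 t0 t1.
have [->|t_neq0] := eqVneq t 0; first by rewrite mul0r add0r subr0 mul1r.
apply: ltr_wpDr; first by rewrite mulr_ge0 ?subr_ge0 // ltW.
by rewrite mulr_gt0 // lt_def t_neq0.
Qed.

(** For j = 0 there is no earlier point to separate from, and the pair (0, 0)
serves; in the other cases [separating_pair] applies to the hull of the
predecessors of x j. *)
Lemma conv_packing_separation (R : realType) (d : nat) (G K : set 'rV[R]_d)
    (alpha theta : R) (N : nat) (x : 'I_N -> 'rV[R]_d)
    (GKpos : forall g y, G g -> polar K y -> 0 < polar_form y g)
    (theta_lt : theta < alpha)
    (Gx : forall i, G (x i))
    (xsep : forall j : 'I_N, (0 < j)%N ->
       alpha <= hilbert_dist_set K (x j)
                  (conv_hull [set x i | i in [set i : 'I_N | (i < j)%N]]))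
    (j : 'I_N) :
  exists yz : 'rV[R]_d * 'rV[R]_d, [/\ polar K yz.1, polar K yz.2 &
    forall i : 'I_N, (i < j)%N ->
      expR (2 * theta) * (polar_form yz.1 (x i) * polar_form yz.2 (x j)) <=
      polar_form yz.1 (x j) * polar_form yz.2 (x i)].
Proof.
case: (posnP j) => [j0|j_gt0].
  by exists (0, 0); split=> [||i]; [exact: polar0..|rewrite j0].
pose S := [set x i | i in [set i : 'I_N | (i < j)%N]].
have [||||y [z [Ky Kz yz]]] := @separating_pair _ _ K (conv_hull S)
    (@conv_hull_segment_closed _ _ _) (x j)
    [seq x i | i : 'I_N <- enum 'I_N & (i < j)%N] theta.
- by move=> y; exact: GKpos.
- move=> y c Ky; apply: conv_hull_polar_form_gt0 => _ [i _ <-].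
  exact: GKpos.
- move=> c /mapP[i]; rewrite mem_filter => /andP[ij _] ->.
  by apply: sub_gen_smallest; exists i.
- move=> c Sc; apply: lt_le_trans theta_lt (le_trans (xsep j j_gt0) _).
  apply: ge_inf; last by exists c.
  by exists 0 => _ [c' _ <-]; exact: hilbert_dist_ge0.
exists (y, z); split=> // i ij; apply: yz; apply: map_f.
by rewrite mem_filter ij mem_enum.
Qed.

(** Inside a cluster the pairs (y j, z j) are interchangeable with (a, b): of the
separation factor e^3, two factors e are lost to the distances from y j to a and
from z j to b, and one remains. The cluster thus yields a chain along which
f_a / f_b grows by e at each step, and then a packing of the segment
from b to a with as many points as the cluster. *)
Lemma cluster_card (R : realType) (d : nat) (G A : set 'rV[R]_d)
    (delta B beta : R) (N M : nat) (delta_gt0 : 0 < delta)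
    (beta_gt0 : 0 < beta) (A_seg : segment_closed A)
    (LB : forall u i, polar (polar G) u -> `|u ord0 i| <= B)
    (LA : forall u w, polar (polar G) u -> A w -> delta <= polar_form u w)
    (maxM : forall n, hilbert_packing A (polar G) beta n -> (n <= M)%N)
    (x : 'I_N -> 'rV[R]_d) (Gx : forall i, G (x i))
    (y z : 'I_N -> 'rV[R]_d) (Ay : forall i, A (y i)) (Az : forall i, A (z i))
    (sep : forall i j : 'I_N, (i < j)%N ->
       expR (2 * (3 * beta)) * (polar_form (y j) (x i) * polar_form (z j) (x j))
       <= polar_form (y j) (x j) * polar_form (z j) (x i))
    (a b : 'rV[R]_d) (Aa : A a) (Ab : A b) (J : {set 'I_N})
    (ya : forall j, j \in J -> hilbert_dist (polar G) a (y j) < beta)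
    (zb : forall j, j \in J -> hilbert_dist (polar G) b (z j) < beta) :
  (#|J| <= M)%N.
Proof.
have [->|[v0 v0J]] := set_0Vmem J; first by rewrite cards0.
case: (arg_maxnP (fun w : 'I_N => (w : nat)) v0J) => v vJ vmax.
set e := expR (2 * beta).
have e_gt0 : 0 < e by exact: expR_gt0.
have LG i : polar (polar G) (x i) by exact/sub_bipolar/Gx.
have pos i w : A w -> 0 < polar_form (x i) w.
  by move=> Aw; apply: lt_le_trans (LA _ _ (LG i) Aw).
have close c w i j : A c -> A w -> hilbert_dist (polar G) c w < beta ->
    polar_form (x i) c * polar_form (x j) w <=
    e * (polar_form (x i) w * polar_form (x j) c).
  move=> Ac Aw cw; have := hilbert_dist_ge delta_gt0 LB
    (fun u Lu => LA u _ Lu Ac) (fun u Lu => LA u _ Lu Aw) (LG i) (LG j).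
  move/le_trans; apply; rewrite ler_pM2r ?mulr_gt0 ?pos //.
  by rewrite ler_expR ler_pM2l // ltW.
pose r i := polar_form (x i) a / polar_form (x i) b.
have step i j : i \in J -> j \in J -> (i < j)%N -> e * r i <= r j.
  move=> iJ jJ ij; have H := sep i j ij.
  have H1 := close a (y j) i j Aa (Ay j) (ya j jJ).
  have H2 := close b (z j) j i Ab (Az j) (zb j jJ).
  have e3 : expR (2 * (3 * beta)) = e * (e * e).
    by rewrite -!expRD; congr expR; ring.
  rewrite !(polar_formC (y j)) !(polar_formC (z j)) e3 in H.
  have := (pos i _ (Ay j), pos j _ (Ay j), pos i _ (Az j), pos j _ (Az j)).
  have := (pos i _ Aa, pos j _ Aa, pos i _ Ab, pos j _ Ab).
  rewrite /r; move: H H1 H2.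
  move: (polar_form (x i) (y j)) (polar_form (x j) (y j)) => yi yj.
  move: (polar_form (x i) (z j)) (polar_form (x j) (z j)) => zi zj.
  move: (polar_form (x i) a) (polar_form (x j) a) => ai aj.
  move: (polar_form (x i) b) (polar_form (x j) b) => bi bj.
  move=> H H1 H2 [[[ai0 aj0] bi0] bj0] [[[yi0 yj0] zi0] zj0].
  rewrite mulrA ler_pdivlMr // mulrAC ler_pdivrMr //.
  have c0 : 0 < e * e * (yi * zj) by rewrite !mulr_gt0.
  rewrite -(ler_pM2l c0).
  have -> : e * e * (yi * zj) * (e * ai * bj) =
            ai * bj * (e * (e * e) * (yi * zj)) by ring.
  apply: (@le_trans _ _ (ai * bj * (yj * zi))).
    by rewrite ler_pM2l ?mulr_gt0.
  have -> : ai * bj * (yj * zi) = (ai * yj) * (bj * zi) by ring.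
  have -> : e * e * (yi * zj) * (aj * bi) =
            (e * (yi * aj)) * (e * (zj * bi)) by ring.
  by rewrite ler_pM // ltW // mulr_gt0.
have [u uJ growth] := chain_growth (ltW e_gt0) step vJ vmax.
have Jcard : #|J|.-1.+1 = #|J| by rewrite prednK //; apply/card_gt0P; exists v.
rewrite -Jcard; apply: maxM.
apply: (segment_packing delta_gt0 beta_gt0 A_seg LB LA Aa Ab (LG u) (LG v)).
exact: growth.
Qed.

Lemma card_le_fibers (T U : finType) (f : T -> U) (m : nat) :
  (forall c, (#|[set t | f t == c]%SET| <= m)%N) -> (#|T| <= #|U| * m)%N.
Proof.
move=> fm; rewrite -sum1_card (partition_big f predT) //=.
rewrite -sum_nat_const; apply: leq_sum => c _.
by rewrite sum1dep_card; exact: fm.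
Qed.




Theorem corollary4p6 (R : realType) (d : nat) (G K : set 'rV[R]_d)
    (G_body : convex_body G) (K_body : convex_body K)
    (G0 : interior G 0) (GK : G `<=` interior K)
    (alpha : R) (alpha_gt0 : 0 < alpha) :
  (hilbert_conv_packing_number G K alpha <=
     11 * hilbert_packing_number (polar K) (polar G) (3 * alpha / 16) ^ 3)%N.
Proof.
have [cG _ _] := G_body.
have [delta [B [delta_gt0 B_ge0 KB LB LK]]] := polar_bounds cG G0 GK.
set beta := 3 * alpha / 16; have beta_gt0 : 0 < beta by rewrite /beta; lra.
set M := hilbert_packing_number _ _ _.
have K_seg : segment_closed (polar K) by exact: polar_segment_closed.
have [m Hm] := hilbert_packing_bounded delta_gt0 B_ge0 beta_gt0 KB LB LK.
have [[c [Kc csep]] maxM] : hilbert_packing (polar K) (polar G) beta M /\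
    forall n, hilbert_packing (polar K) (polar G) beta n -> (n <= M)%N.
  apply: (nat_maxP (n := 0)) Hm.
  by exists (fun=> 0); split=> [i|[]]; [exact: polar0|].
have cover y : polar K y -> exists i, hilbert_dist (polar G) (c i) y < beta.
  apply: hilbert_packing_cover => //.
  by move/maxM; rewrite ltnn.
rewrite /hilbert_conv_packing_number /nat_max.
set Q := [set N | _]; have [exQ|noQ] := pselect (exists N, Q N); last first.
  by rewrite xgetPN // => N QN; apply: noQ; exists N.
have [[x [Gx xsep]] _] := xgetPex 0%N exQ.
set N := xget 0%N Q in x Gx xsep *.
have GKpos g y : G g -> polar K y -> 0 < polar_form y g.
  move=> Gg Ky; rewrite polar_formC.
  exact: lt_le_trans (LK _ _ (sub_bipolar Gg) Ky).
have lt_alpha : 3 * beta < alpha by rewrite /beta; lra.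
have [yz Hyz] := choice (conv_packing_separation GKpos lt_alpha Gx xsep).
have Ky j : polar K (yz j).1 by have [] := Hyz j.
have Kz j : polar K (yz j).2 by have [] := Hyz j.
have [p Hp] := choice (fun j => cover _ (Ky j)).
have [q Hq] := choice (fun j => cover _ (Kz j)).
apply: (@leq_trans (M * M * M)); last first.
  by rewrite -[leqLHS]mul1n -mulnA; apply: leq_mul => //; rewrite !expnS.
have := @card_le_fibers _ _ (fun j => (p j, q j)) M.
rewrite card_prod !card_ord; apply => -[a b].
apply: (cluster_card delta_gt0 beta_gt0 K_seg LB LK maxM Gx Ky Kz _
  (Kc a) (Kc b)) => [i j|j|j].
- by have [_ _] := Hyz j; exact.
- by rewrite inE => /eqP[<- _].
- by rewrite inE => /eqP[_ <-].
Qed.
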